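(* Let $\mathsf{L}$ and $\mathsf{H}$ be simplicial complexes, and let $\mathsf{A}$, $\mathsf{B}$ be facet subcomplexes of $\mathsf{L}$ such that $\mathsf{L}=\mathsf{A}\cup\mathsf{B}$. Then: (1) $\max\{\mathrm{C}(\mathsf{A};\mathsf{H}),\mathrm{C}(\mathsf{B};\mathsf{H})\}\leq \mathrm{C}(\mathsf{L};\mathsf{H})\leq \mathrm{C}(\mathsf{A};\mathsf{H})+\mathrm{C}(\mathsf{B};\mathsf{H})$. (2) $\max\{\mathrm{IC}(\mathsf{A};\mathsf{H}),\mathrm{IC}(\mathsf{B};\mathsf{H})\}\leq \mathrm{IC}(\mathsf{L};\mathsf{H})\leq \mathrm{IC}(\mathsf{A};\mathsf{H})+\mathrm{IC}(\mathsf{B};\mathsf{H})$.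
   Context: A simplicial complex is an abstract simplicial complex: a set $\mathsf{K}$ of subsets (simplices) of a vertex set $V(\mathsf{K})=\bigcup\mathsf{K}$ such that $F\in\mathsf{K}$ and $G\subseteq F$ imply $G\in\mathsf{K}$. A facet is a simplex that is maximal with respect to inclusion; a facet is non-unitary if it has at least two vertices. A subcomplex of $\mathsf{K}$ is a simplicial complex contained in $\mathsf{K}$. A subcomplex $\mathsf{A}$ of $\mathsf{L}$ is a facet subcomplex if every facet of $\mathsf{A}$ is a facet of $\mathsf{L}$. The union of simplicial complexes is the union of their vertex sets and of their sets of simplices. A simplicial map $f:\mathsf{L}\to\mathsf{K}$ is a map $f:V(\mathsf{L})\to V(\mathsf{K})$ such that $f(F)\in\mathsf{K}$ whenever $F\in\mathsf{L}$; it is injective if it is injective on vertices. A facet simplicial map is a simplicial map $f:\mathsf{L}\to\mathsf{K}$ such that $f(F)$ is a non-unitary facet of $\mathsf{K}$ whenever $F$ is a non-unitary facet of $\mathsf{L}$. The facet-complexity $\mathrm{C}(\mathsf{L};\mathsf{K})$ is the least positive integer $k$ such that there exist subcomplexes $\mathsf{L}_1,\ldots,\mathsf{L}_k$ of $\mathsf{L}$ with $\mathsf{L}=\mathsf{L}_1\cup\cdots\cup\mathsf{L}_k$ and, for each $i$, a facet simplicial map $f_i:\mathsf{L}_i\to\mathsf{K}$; it is $\infty$ if no such $k$ exists. The injective facet-complexity $\mathrm{IC}(\mathsf{L};\mathsf{K})$ is defined in the same way, requiring each $f_i$ to be an injective facet simplicial map. *)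

(* Defs.v *)
From mathcomp Require Export all_boot all_order all_algebra.
From mathcomp Require Export boolp classical_sets constructive_ereal.

Set Implicit Arguments.
Unset Strict Implicit.
Unset Printing Implicit Defensive.

Local Open Scope classical_set_scope.

(* Neither vertex sets nor simplices are assumed finite. The complex with no
   simplex at all is allowed; any other one has set0 as a simplex. *)
Record complex (T : Type) := Complex {
  simplices : set (set T);
  face_closed : forall F G : set T, simplices F -> G `<=` F -> simplices G }.

Definition vertices (T : Type) (K : complex T) : set T :=
  \bigcup_(F in simplices K) F.

Definition facet (T : Type) (K : complex T) (F : set T) : Prop :=
  simplices K F /\ (forall G, simplices K G -> F `<=` G -> G = F).

Definition nonunitary_facet (T : Type) (K : complex T) (F : set T) : Prop :=
  facet K F /\ exists x y, [/\ F x, F y & x <> y].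

Definition subcomplex (T : Type) (A L : complex T) : Prop :=
  simplices A `<=` simplices L.

Definition facet_subcomplex (T : Type) (A L : complex T) : Prop :=
  subcomplex A L /\ (forall F, facet A F -> facet L F).

(* Vertex maps are functions between the subtypes of vertices, so that the
   empty map is available when [vertices L] is empty, whatever U is. *)
Definition vertex_map (T U : Type) (L : complex T) (K : complex U) : Type :=
  vertices L -> vertices K.

Definition map_image (T U : Type) (L : complex T) (K : complex U)
    (f : vertex_map L K) (F : set T) : set U :=
  [set val (f x) | x in [set x : vertices L | F (val x)]].

Definition simplicial (T U : Type) (L : complex T) (K : complex U)
    (f : vertex_map L K) : Prop :=
  forall F, simplices L F -> simplices K (map_image f F).

Definition facet_simplicial (T U : Type) (L : complex T) (K : complex U)
    (f : vertex_map L K) : Prop :=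
  simplicial f /\
  (forall F, nonunitary_facet L F -> nonunitary_facet K (map_image f F)).

(* L is the union of k subcomplexes satisfying P. Equality of the sets of
   simplices is enough: it entails equality of the vertex sets. *)
Definition covered_by (T : Type) (L : complex T) (P : complex T -> Prop)
    (k : nat) : Prop :=
  exists M : 'I_k -> complex T,
    [/\ forall i, subcomplex (M i) L,
        simplices L = \bigcup_(i in [set: 'I_k]) simplices (M i) &
        forall i, P (M i)].

Definition least_positive (P : nat -> Prop) : \bar int :=
  if pselect (exists k, `[< (0 < k)%N /\ P k >]) is left ex
  then (Posz (ex_minn ex))%:E else +oo%E.

Definition facet_complexity (T U : Type) (L : complex T) (K : complex U) :
    \bar int :=
  least_positive
    (covered_by L (fun M => exists f : vertex_map M K, facet_simplicial f)).

Definition injective_facet_complexity (T U : Type) (L : complex T)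
    (K : complex U) : \bar int :=
  least_positive
    (covered_by L (fun M =>
       exists f : vertex_map M K, facet_simplicial f /\ injective f)).

(* Main.v *)
(* The upper bounds concatenate a covering of A with a covering of B. For the
   lower bounds, take a covering of L by L_1, ..., L_k. The intersections of
   the L_i with A will not do, as they may have facets that are not facets of
   L_i, and simplices of A need not lie in facets of A, since complexes may be
   infinite. Instead let A_i consist of the faces of those G in A all of whose
   cofaces in A belong to L_i. A facet of A_i is then a facet of A, hence of L,
   hence of L_i. The A_i cover A: given F in A, choose a coface G of F in A that
   belongs to as few of the L_i as possible; each L_i containing G contains all
   cofaces of G in A. *)
Require Import Defs.
From mathcomp Require Import all_boot all_order all_algebra.
From mathcomp Require Import boolp classical_sets constructive_ereal.

Local Open Scope classical_set_scope.
Local Open Scope ereal_scope.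

Lemma least_positive_le (P Q : nat -> Prop) :
  (forall k, P k -> Q k) -> least_positive Q <= least_positive P.
Proof.
move=> PQ; rewrite /least_positive.
case: (pselect (exists k, `[< (0 < k)%N /\ P k >])) => [exP|_]; last exact: leey.
case: pselect => [exQ|nexQ].
  rewrite lee_fin lez_nat; case: ex_minnP => m _ m_min.
  case: ex_minnP => n /asboolP[n_gt0 Pn] _.
  by apply/m_min/asboolP; split=> //; exact: PQ.
case: nexQ; case: exP => n /asboolP[n_gt0 Pn].
by exists n; apply/asboolP; split=> //; exact: PQ.
Qed.

Lemma least_positiveD (P Q S : nat -> Prop) :
  (forall m n, P m -> Q n -> S (m + n)%N) ->
  least_positive S <= least_positive P + least_positive Q.
Proof.
move=> PQS; rewrite /least_positive.
(* No value of [least_positive] is [-oo], so the sum is [+oo] as soon as one of its terms is. *)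
case: (pselect (exists k, `[< (0 < k)%N /\ P k >])) => [exP|_]; last first.
  by case: (pselect (exists k, `[< (0 < k)%N /\ Q k >])) => ?; exact: leey.
case: (pselect (exists k, `[< (0 < k)%N /\ Q k >])) => [exQ|_]; last exact: leey.
case: ex_minnP => m /asboolP[m_gt0 Pm] _.
case: ex_minnP => n /asboolP[n_gt0 Qn] _.
have Smn : `[< (0 < m + n)%N /\ S (m + n)%N >].
  by apply/asboolP; split; [rewrite addn_gt0 m_gt0|exact: PQS].
case: pselect => [exS|nexS]; last by case: nexS; exists (m + n)%N.
rewrite -EFinD lee_fin -PoszD lez_nat.
by case: ex_minnP => s _; apply.
Qed.

Lemma covered_byU (T : Type) (L A B : complex T) (P : complex T -> Prop)
    (m n : nat) :
  simplices L = simplices A `|` simplices B ->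
  covered_by A P m -> covered_by B P n -> covered_by L P (m + n).
Proof.
move=> LAB [M [MA AE PM]] [N [NB BE PN]].
exists (fun i => match split i with inl j => M j | inr j => N j end); split.
- move=> i F; rewrite LAB; case: split => j FMN; first by left; exact: MA FMN.
  by right; exact: NB FMN.
- rewrite LAB AE BE; apply/seteqP; split=> F.
    (* The first [m] indices run through the covering of [A], the last [n] through that of [B]. *)
    case=> -[j _ Fj]; first by exists (unsplit (inl j)); rewrite ?unsplitK.
    by exists (unsplit (inr j)); rewrite ?unsplitK.
  case=> i _; case: split => j Fj; first by left; exists j.
  by right; exists j.
- by move=> i; case: split.
Qed.

Section StableCofaces.
Variables (T : Type) (A M : complex T).

(** With [M] one of the [L_i], these are the simplices of [A_i]; [G] is one of its own cofaces,
    hence lies in [M]. *)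
Definition stable_simplices : set (set T) :=
  [set F | exists2 G, simplices A G & F `<=` G /\
     forall G', simplices A G' -> G `<=` G' -> simplices M G'].

Lemma stable_face_closed F G :
  stable_simplices F -> G `<=` F -> stable_simplices G.
Proof.
move=> [K AK [FK KM]] GF; exists K => //.
by split=> //; exact: subset_trans FK.
Qed.

Definition stable_part : complex T := Complex stable_face_closed.

Lemma stable_part_subl : subcomplex stable_part A.
Proof. by move=> F [G AG [FG _]]; exact: face_closed AG FG. Qed.

Lemma stable_part_subr : subcomplex stable_part M.
Proof. by move=> F [G AG [FG GM]]; exact: face_closed (GM _ AG _) FG. Qed.

(** If [K] witnesses that [F] is stable, every coface of [K] in [A] is stable too. Maximality of [F]
    gives first [K = F], then that [F] has no larger coface in [A]. *)
Lemma facet_stable_part F : facet stable_part F -> facet A F.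
Proof.
move=> [stF Fmax]; split; first exact: stable_part_subl.
move=> G AG FG; case: stF => K AK [FK KM].
have stable_coface G' : simplices A G' -> K `<=` G' -> stable_simplices G'.
  move=> AG' KG'; exists G' => //; split=> // G'' AG'' G'G''.
  by apply: KM => //; exact: subset_trans G'G''.
have KF : K = F by apply: Fmax => //; exact: stable_coface.
by apply: Fmax => //; apply: stable_coface => //; rewrite KF.
Qed.

(** A facet of the stable part is a facet of [A], hence of [L]; being maximal in [L] and lying in
    [M], it is maximal in [M]. *)
Lemma stable_part_facet_subcomplex (L : complex T) :
  facet_subcomplex A L -> subcomplex M L -> facet_subcomplex stable_part M.
Proof.
move=> [_ facetAL] ML; split; first exact: stable_part_subr.
move=> F facetF; have [_ Fmax] := facetAL _ (facet_stable_part _ facetF).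
split; first by apply: stable_part_subr; case: facetF.
by move=> G /ML; exact: Fmax.
Qed.

End StableCofaces.

Lemma stable_parts_cover (T : Type) (A : complex T) (k : nat)
    (M : 'I_k -> complex T) :
  simplices A `<=` \bigcup_(i in [set: 'I_k]) simplices (M i) ->
  simplices A = \bigcup_(i in [set: 'I_k]) simplices (stable_part T A (M i)).
Proof.
move=> AM; apply/seteqP; split=> [F AF|F [i _ /stable_part_subl]] //.
(* [I G] collects the indices of the [M i] containing [G]. It is finite, so some coface [G] of [F]
   in [A] minimises its cardinality. *)
pose I G := [set i : 'I_k | `[< simplices (M i) G >]]%SET.
pose Q n := exists G, [/\ simplices A G, F `<=` G & #|I G| = n].
have exQ : exists n, `[< Q n >].
  by exists #|I F|; apply/asboolP; exists F; split.
case: (ex_minnP exQ) => n /asboolP[G [AG FG <-]] Gmin.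
have [i _ iG] := AM _ AG; exists i => //; exists G => //; split=> // G' AG' GG'.
(* Face closure makes [I] decreasing, so [I G'] lies in [I G]; [G'] is also a coface of [F], and
   minimality forces equality. *)
have I_eq : I G' = I G.
  apply/eqP; rewrite eqEcard; apply/andP; split.
    apply/fintype.subsetP => j; rewrite !inE => jG'.
    exact: face_closed jG' GG'.
  by apply: Gmin; apply/asboolP; exists G'; split=> //; exact: subset_trans GG'.
have : i \in I G by rewrite !inE.
by rewrite -I_eq !inE.
Qed.

Lemma covered_by_facet_subcomplex (T : Type) (A L : complex T)
    (P : complex T -> Prop) (k : nat) :
  (forall M N, facet_subcomplex N M -> P M -> P N) ->
  facet_subcomplex A L -> covered_by L P k -> covered_by A P k.
Proof.
move=> Pfacet AL [M [ML LE PM]]; exists (fun i => stable_part T A (M i)); split.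
- by move=> i; exact: stable_part_subl.
- by apply: stable_parts_cover; rewrite -LE; exact: AL.1.
- move=> i; apply: Pfacet (PM i).
  exact: stable_part_facet_subcomplex AL (ML i).
Qed.

Section Restriction.
Variables (T U : Type) (N M : complex T) (K : complex U).
Hypothesis NM : subcomplex N M.

Lemma vertices_subcomplex : vertices N `<=` vertices M.
Proof. by move=> x [F NF Fx]; exists F => //; exact: NM. Qed.

(** Vertex maps live on subtypes, so restricting one to [N] means composing it with this
    inclusion. *)
Definition vertex_incl (x : vertices N) : vertices M :=
  SigSub (mem_set (vertices_subcomplex _ (set_mem (valP x)))).

Lemma vertex_incl_inj : injective vertex_incl.
Proof. by move=> x y /(congr1 val) /= ?; exact: val_inj. Qed.

Lemma map_image_restrict (f : vertex_map M K) F : simplices N F ->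
  map_image (f \o vertex_incl : vertex_map N K) F = map_image f F.
Proof.
move=> NF; apply/seteqP; split=> y [x /= Fx <-]; first by exists (vertex_incl x).
(* As [F] is a simplex of [N], all its points are vertices of [N]. *)
have Nx : val x \in vertices N by apply/mem_set; exists F.
exists (SigSub Nx) => //=; congr (val (f _)); exact: val_inj.
Qed.

Lemma facet_simplicial_restrict (f : vertex_map M K) :
  facet_subcomplex N M -> facet_simplicial f ->
  facet_simplicial (f \o vertex_incl : vertex_map N K).
Proof.
move=> [_ facetNM] [simf facetf]; split=> [F NF|F [facetF F2]].
  by rewrite map_image_restrict //; exact/simf/NM.
rewrite map_image_restrict; last by case: facetF.
by apply: facetf; split=> //; exact: facetNM.
Qed.

End Restriction.

(** Common form of both claims: [P] will be the existence of a facet simplicial map to [H],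
    injective in the second case. Restriction of maps shows that [P] passes to facet
    subcomplexes. *)
Lemma least_positive_covered_by (T : Type) (L A B : complex T)
    (P : complex T -> Prop) :
  (forall M N, facet_subcomplex N M -> P M -> P N) ->
  facet_subcomplex A L -> facet_subcomplex B L ->
  simplices L = simplices A `|` simplices B ->
  maxe (least_positive (covered_by A P)) (least_positive (covered_by B P))
    <= least_positive (covered_by L P)
    <= least_positive (covered_by A P) + least_positive (covered_by B P).
Proof.
move=> Pfacet hA hB hL; apply/andP; split.
  rewrite Order.TotalTheory.ge_max; apply/andP.
  by split; apply: least_positive_le => k; exact: covered_by_facet_subcomplex.
by apply: least_positiveD => m n; exact: covered_byU.
Qed.

Theorem theorem3p11 (T U : Type) (L A B : complex T) (H : complex U)
  (hA : facet_subcomplex A L) (hB : facet_subcomplex B L)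
  (hL : simplices L = simplices A `|` simplices B) :
  (maxe (facet_complexity A H) (facet_complexity B H)
     <= facet_complexity L H
     <= facet_complexity A H + facet_complexity B H) /\
  (maxe (injective_facet_complexity A H) (injective_facet_complexity B H)
     <= injective_facet_complexity L H
     <= injective_facet_complexity A H + injective_facet_complexity B H).
Proof.
split; apply: least_positive_covered_by => // M N NM.
  move=> [f facetf]; exists (f \o vertex_incl _ _ _ NM.1).
  exact: facet_simplicial_restrict.
move=> [f [facetf injf]]; exists (f \o vertex_incl _ _ _ NM.1); split.
  exact: facet_simplicial_restrict.
exact: inj_comp injf (vertex_incl_inj _ _ _ _).
Qed.
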